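(* Let $f:\Sigma\to\Sigma$ be a measurable map on a topological space $\Sigma$, let $\mu$ be an $f$-invariant ergodic probability measure, and let $\tau$ be a $\mu$-integrable roof function on $\Sigma$ that is bounded away from zero. Let $(X_t)_t$ be the suspension semiflow associated to $(f,\Sigma,\tau)$ on $\Sigma_\tau$ and let $\bar\mu=\frac{(\mu\times m)|_{\Sigma_\tau}}{\int_\Sigma\tau\,d\mu}$ be the ergodic $(X_t)_t$-invariant probability measure associated to $\mu$. Let $A=A_{h_1,h_2}\in\mathcal A$ with $\bar\mu(A)>0$, and let $I=\pi_1(A)$. Then $$ \int_A n_A(x,t)\,d\bar\mu_A=\int_A e_A(x,t)\,d\bar\mu_A+\frac{\int_I h(x)\,\tau^{n_I}(x)\,d\mu}{\int_I h(x)\,d\mu}+\frac{\int_I h(x)\,\big[h_1(f^{n_I(x)}(x))-h_2(x)\big]\,d\mu}{\int_I h(x)\,d\mu}, $$ where $h(x)=h_2(x)-h_1(x)$ and $\tau^{n_I}(x)=\sum_{k=0}^{n_I(x)-1}\tau(f^k(x))$, and also $$ \int_A e_A(x,t)\,d\bar\mu_A=\frac{\int_I h(x)\,\Big[\frac{h_2(x)-h_1(x)}{2}\Big]\,d\mu}{\int_I h(x)\,d\mu}. $$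
   Context: Suspension: given a measurable map $f:\Sigma\to\Sigma$ and a roof function $\tau:\Sigma\to(0,\infty)$ bounded away from zero, let $\Sigma_\tau=\{(x,s)\in\Sigma\times[0,\infty):0\le s\le\tau(x)\}/\sim$, where $(x,\tau(x))\sim(f(x),0)$ for every $x\in\Sigma$. The suspension (semi)flow $(X_s)_{s\ge0}$ on $\Sigma_\tau$ is $$X_s(x,t)=\Big(f^k(x),\,t+s-\sum_{j=0}^{k-1}\tau(f^j(x))\Big),$$ where $k=k(x,t,s)\ge0$ is determined by $\sum_{j=0}^{k-1}\tau(f^j(x))\le t+s<\sum_{j=0}^{k}\tau(f^j(x))$. $m$ denotes Lebesgue measure on $\mathbb R$, and $\bar\mu_A(\cdot)=\bar\mu(\cdot\cap A)/\bar\mu(A)$. $\pi_1:\Sigma_\tau\to\Sigma$ is the natural projection. $\mathcal A$ is the family of closed sets whose boundaries are graphs of functions over $\Sigma$; more precisely, $A\in\mathcal A$ if and only if there are measurable functions $h_1,h_2:\pi_1(A)\to[0,\infty)$, with $h_1(x)\le h_2(x)\le\tau(x)$ for every $x\in\pi_1(A)$, such that $A=\{(x,t)\in\Sigma_\tau: x\in\pi_1(A),\ h_1(x)\le t\le h_2(x)\}$; such a set is denoted $A_{h_1,h_2}$. For $A\subset\Sigma_\tau$, the escape time is $e_A(x,t)=\inf\{s>0:X_s(x,t)\notin A\}$ and the hitting time (whose restriction to $A$ is the return time) is $n_A(x,t)=\inf\{s>e_A(x,t):X_s(x,t)\in A\}$. For $I\subset\Sigma$, $n_I(x)=\inf\{k\ge1:f^k(x)\in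 I\}$ is the first hitting time to $I$ under $f$.
   Formalization: Assumes that for μ-a.e. x it is not the case that x, f(x) ∈ I, h_2(x)=τ(x) and h_1(f(x))=0 (otherwise false, e.g. A=Σ_τ with τ bounded); the first formula is stated only when its right-hand side is not of the form +∞−∞. *)

(* Defs.v *)
(* MathComp-Analysis *)
From mathcomp Require Import all_boot all_order all_algebra.
From mathcomp Require Import all_classical all_reals all_analysis.
From Stdlib Require Import Relation_Operators.

Set Implicit Arguments.
Unset Strict Implicit.
Unset Printing Implicit Defensive.

Import Order.TTheory GRing.Theory Num.Theory.
Import numFieldNormedType.Exports.

Local Open Scope classical_set_scope.
Local Open Scope ring_scope.

(* a topological space seen as a measurable space, with its Borel sigma-algebra *)
Notation borel T := (g_sigma_algebraType (@open T)).

Section measure_preserving.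
Context d (T : measurableType d) (R : realType).

Definition invariant_measure (mu : {measure set T -> \bar R}) (f : T -> T) :=
  forall B : set T, measurable B -> mu (f @^-1` B) = mu B.

Definition ergodic_measure (mu : {measure set T -> \bar R}) (f : T -> T) :=
  forall B : set T, measurable B -> f @^-1` B = B -> mu B = 0%E \/ mu B = 1%E.

End measure_preserving.

Section suspension.
Context (T : pointedType) (R : realType) (f : T -> T) (tau : T -> R).

Definition roof_sum (n : nat) (x : T) : R := \sum_(j < n) tau (iter j f x).

Definition susp_strip : set (T * R) := [set p | 0 <= p.2 <= tau p.1].

Definition susp_glue (p q : T * R) : Prop :=
  exists x, p = (x, tau x) /\ q = (f x, 0).

(* The quotient of [susp_strip] by the equivalence relation generated by
   [susp_glue], each class being represented by its unique point (x, t) with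
   0 <= t < tau x (see [susp_transversal]).  In these coordinates the
   projection onto T is [fst]. *)
Definition susp : set (T * R) := [set p | 0 <= p.2 < tau p.1].

Lemma susp_transversal : (forall x, 0 < tau x) ->
  forall p, susp_strip p ->
  exists! q, susp q /\ clos_refl_sym_trans _ susp_glue p q.
Proof.
move=> tau_gt0 p /andP[p0 ptau].
pose c (q : T * R) := if q.2 == tau q.1 then (f q.1, 0) else q.
have c_glue a b : clos_refl_sym_trans _ susp_glue a b -> c a = c b.
  elim=> [u v [x [-> ->]]|//|u v _ -> //|u v w _ -> _ -> //].
  by rewrite /c/= eqxx eq_sym gt_eqF.
have c_susp q : susp q -> c q = q.
  by move=> /andP[_ qtau]; rewrite /c lt_eqF.
exists (c p); split.
  rewrite /c; case: eqVneq => ptau'.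
    split; first by rewrite /susp/= lexx tau_gt0.
    by apply: rst_step; exists p.1; rewrite -ptau' -surjective_pairing.
  split; last exact: rst_refl.
  by rewrite /susp/= p0 lt_neqAle ptau' ptau.
by move=> q [/c_susp {2}<- /c_glue].
Qed.

(* unique when tau is bounded away from zero *)
Definition lap_number (p : T * R) (s : R) : nat :=
  xget 0%N [set k | roof_sum k p.1 <= p.2 + s < roof_sum k.+1 p.1].

Definition susp_flow (s : R) (p : T * R) : T * R :=
  let k := lap_number p s in (iter k f p.1, p.2 + s - roof_sum k p.1).

(* +oo when the orbit never escapes (ereal_inf set0 = +oo) *)
Definition escape_time (A : set (T * R)) (p : T * R) : \bar R :=
  ereal_inf [set s%:E | s in [set s : R | 0 < s /\ ~ A (susp_flow s p)]].

Definition hitting_time (A : set (T * R)) (p : T * R) : \bar R :=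
  ereal_inf [set s%:E | s in
    [set s : R | (escape_time A p < s%:E)%E /\ A (susp_flow s p)]].

(* 0 when the orbit never enters I; by recurrence this concerns only a
   negligible set of x in I *)
Definition first_hit (I : set T) (x : T) : nat :=
  xget 0%N [set k | [/\ (0 < k)%N, I (iter k f x) &
    forall j, (0 < j)%N -> I (iter j f x) -> (k <= j)%N]].

End suspension.

Section suspension_measure.
Context d (T : measurableType d) (R : realType).
Local Open Scope ereal_scope.

Definition susp_measure (mu : {measure set T -> \bar R}) (tau : T -> R)
    (B : set (T * R)) : \bar R :=
  (mu \x lebesgue_measure) (B `&` susp tau) / \int[mu]_x (tau x)%:E.

Definition cond_measure (nu : set (T * R) -> \bar R) (A B : set (T * R)) :
    \bar R :=
  nu (B `&` A) / nu A.

(* A = A_{h1,h2}; only the values of h1 and h2 over the projection of A matter *)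
Definition graph_bounded (tau : T -> R) (A : set (T * R)) (h1 h2 : T -> R) :=
  let I := fst @` A in
  [/\ measurable I,
      measurable_fun I h1,
      measurable_fun I h2,
      forall x, I x -> (0 <= h1 x)%R /\ (h1 x <= h2 x <= tau x)%R &
      A = [set p | [/\ susp tau p, I p.1 & (h1 p.1 <= p.2 <= h2 p.1)%R]]].

(* Where h2 x = tau x, I (f x) and h1 (f x) = 0, the fibres of A over x and f x
   are joined by the gluing (x, tau x) ~ (f x, 0), and (x, h2 x) is not on the
   boundary of A along the flow.  This excludes for instance A = susp tau, which
   no orbit ever leaves. *)
Definition separated_fibres (mu : {measure set T -> \bar R}) (f : T -> T)
    (tau : T -> R) (I : set T) (h1 h2 : T -> R) :=
  {ae mu, forall x, ~ [/\ I x, h2 x = tau x, I (f x) & h1 (f x) = 0%R]}.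

End suspension_measure.

(* Main.v *)
From HB Require Import structures.
Require Import Defs.
From mathcomp Require Import all_boot all_order all_algebra.
From mathcomp Require Import all_classical all_reals all_analysis.
From mathcomp Require Import measurable_realfun lra ring.

(** Almost every orbit starting in [A] leaves it and comes back in a way that
    can be read off the fibres of [A].  Let [x] be a point of the projection
    [I] that returns to [I] under [f], and whose fibre is not glued to the
    fibre over [f x].  Starting from [(x, t)] in [A], the flow goes up until
    height [h2 x], so the escape time is [h2 x - t]; it then stays outside [A]
    until the base point reaches [I] again, after [n = n_I x] laps, and enters
    [A] when the height over [iter n f x] is [h1 (iter n f x)].  The hitting
    time is thus
      [(h2 x - t) + (roof_sum n x + h1 (iter n f x) - h2 x)],
    whose second term does not depend on [t] ([escape_time_region],
    [hitting_time_region]).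

    Up to the factor [1 / \int_I h], the measure conditioned on [A] is the
    restriction to [A] of the product of [mu] with Lebesgue measure.  By
    Tonelli's theorem, integrating [h2 x - t + b x] over [A] amounts to
    integrating over [I] the elementary integral [h x * (h x / 2 + b x)] over
    the fibre ([integral_region]).  With [b = 0] this is the mean escape time,
    and with [b] the second term above it is the mean hitting time.

    The points of [I] that do not return form a null set by Poincare recurrence
    ([poincare_recurrence]), and so do the points with glued fibres, by
    hypothesis.  Escape and hitting times may fail to be measurable over this
    exceptional set when the sigma-algebra is not complete, so null sets are
    discarded by a lemma that requires no measurability of the integrand
    ([integral_setD_null]).

    Finally, the mean of [b] is split into the return term and the height term.
    The height term need not be integrable, but its negative part is dominated
    by the integrand of the return term; hence the two integrals add up as soon
    as their sum is not of the form [+oo - oo] ([integralD_adde_def]). *)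

Set Implicit Arguments.
Unset Strict Implicit.
Unset Printing Implicit Defensive.
Import Order.TTheory GRing.Theory Num.Theory.
Import numFieldNormedType.Exports.
Local Open Scope classical_set_scope.
Local Open Scope ring_scope.
Local Open Scope ereal_scope.

(** * Escape and hitting times of a region between two graphs *)

Section orbits.
Context (T : pointedType) (R : realType) (f : T -> T) (tau : T -> R).
Hypothesis tau_gt0 : forall x, (0 < tau x)%R.

Lemma roof_sumS n x :
  roof_sum f tau n.+1 x = (roof_sum f tau n x + tau (iter n f x))%R.
Proof. by rewrite /roof_sum big_ord_recr. Qed.

Lemma roof_sum0 x : roof_sum f tau 0 x = 0%R.
Proof. by rewrite /roof_sum big_ord0. Qed.

Lemma roof_sum1 x : roof_sum f tau 1 x = tau x.
Proof. by rewrite roof_sumS roof_sum0 add0r. Qed.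

Lemma roof_sum_homo x : {homo (roof_sum f tau)^~ x : m n / (m <= n)%N >-> (m <= n)%R}.
Proof.
by apply: homo_leq => [//|u v w|n]; [exact: le_trans|rewrite roof_sumS lerDl ltW].
Qed.

Lemma susp_flow_lap p s k :
  (roof_sum f tau k p.1 <= p.2 + s < roof_sum f tau k.+1 p.1)%R ->
  susp_flow f tau s p = (iter k f p.1, p.2 + s - roof_sum f tau k p.1)%R.
Proof.
move=> kP; rewrite /susp_flow.
suff -> : lap_number f tau p s = k by [].
apply: xget_unique => // j /andP[ja jb]; move: kP => /andP[ka kb].
apply/eqP; rewrite eqn_leq; apply/andP; split; rewrite leqNgt; apply/negP => lt.
  by have := roof_sum_homo p.1 lt; rewrite leNgt (le_lt_trans ja kb).
by have := roof_sum_homo p.1 lt; rewrite leNgt (le_lt_trans ka jb).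
Qed.

Lemma lap_exists x u n : (0 <= u < roof_sum f tau n.+1 x)%R ->
  exists2 k, (k <= n)%N & (roof_sum f tau k x <= u < roof_sum f tau k.+1 x)%R.
Proof.
move=> /andP[u0 un].
elim: n un => [|n ih] un; first by exists 0%N => //; rewrite roof_sum0 u0.
have [/ih[k kn kP]|nu] := ltP u (roof_sum f tau n.+1 x).
  by exists k => //; exact: leqW.
by exists n.+1 => //; rewrite nu.
Qed.

Section region.
Context (I : set T) (h1 h2 : T -> R).
Hypothesis hI : forall x, I x -> (0 <= h1 x)%R /\ (h1 x <= h2 x <= tau x)%R.
Let A : set (T * R) :=
  [set p | [/\ susp tau p, I p.1 & (h1 p.1 <= p.2 <= h2 p.1)%R]].

(** The flow moves up the fibre, so it leaves [A] at height [h2 x]; if this is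
    the roof, the next point [(f x, 0)] is outside [A] because the fibres over
    [x] and [f x] are not glued. *)
Lemma escape_time_region x t : A (x, t) ->
  ~ [/\ I x, h2 x = tau x, I (f x) & h1 (f x) = 0%R] ->
  escape_time f tau A (x, t) = (h2 x - t)%:E.
Proof.
move=> [/andP[/= t0 tt] /= Ix /andP[h1t th2]] sep.
have [h10 /andP[h12 h2t]] := hI Ix.
apply/eqP; rewrite eq_le; apply/andP; split; last first.
  apply: le_ereal_inf_tmp => _ [s [s0 nA] <-]; rewrite lee_fin leNgt; apply/negP => sl.
  apply: nA; rewrite (@susp_flow_lap _ _ 0%N)/=; last first.
    by rewrite roof_sum0 roof_sum1; apply/andP; split; lra.
  rewrite roof_sum0 subr0; split => //=; rewrite /susp/=; apply/andP; split; lra.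
have [h2lt|h2ge] := ltP (h2 x) (tau x).
  apply/lee_addgt0Pr => e e0.
  (* a height above h2 x, still below the roof, and within e of h2 x *)
  pose r := (Num.min e ((tau x - h2 x) / 2))%R.
  have r0 : (0 < r)%R by rewrite lt_min e0/=; lra.
  have re : (r <= e)%R by rewrite ge_min lexx.
  have rt : (r <= (tau x - h2 x) / 2)%R by rewrite ge_min lexx orbT.
  apply: (@le_trans _ _ (h2 x - t + r)%:E); last first.
    by rewrite -EFinD lee_fin lerD2l.
  apply: ereal_inf_lbound; exists (h2 x - t + r)%R => //; split; first lra.
  rewrite (@susp_flow_lap _ _ 0%N)/=; last first.
    by rewrite roof_sum0 roof_sum1; apply/andP; split; lra.
  by rewrite roof_sum0 subr0 => -[_ _ /= /andP[_]]; lra.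
have h2E : h2 x = tau x by apply/eqP; rewrite eq_le h2t.
apply: ereal_inf_lbound; exists (h2 x - t)%R => //; split; first lra.
rewrite (@susp_flow_lap _ _ 1%N)/=; last first.
  rewrite (roof_sumS 1) roof_sum1 /=; have := tau_gt0 (f x) => ?.
  by apply/andP; split; lra.
rewrite roof_sum1 => -[_ /= Ifx /andP[/= h1f _]].
apply: sep; split => //; have [] := hI Ifx => h1f0 _.
by apply/eqP; rewrite eq_le h1f0 andbT; lra.
Qed.

(** After the escape, the base point is outside [I] during the laps
    [1, ..., n - 1], so [A] is entered at the bottom of its fibre over
    [iter n f x].  The first conclusion says that the entrance is not earlier
    than the escape; only unglued fibres make it strictly later, which is what
    the definition of the hitting time requires.  That [h1] stays below the
    roof over [iter n f x] ensures that the entrance point is a point of the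
    suspension in its canonical coordinates. *)
Lemma hitting_time_region x t n : A (x, t) ->
  ~ [/\ I x, h2 x = tau x, I (f x) & h1 (f x) = 0%R] ->
  (h1 (iter n f x) < tau (iter n f x))%R ->
  [/\ (0 < n)%N, I (iter n f x) &
    forall j, (0 < j)%N -> I (iter j f x) -> (n <= j)%N] ->
  (h2 x <= roof_sum f tau n x + h1 (iter n f x))%R /\
  hitting_time f tau A (x, t) =
    (roof_sum f tau n x + h1 (iter n f x) - t)%:E.
Proof.
move=> Axt sep h1n [n0 In nmin].
have eE := escape_time_region Axt sep.
move: Axt => [/andP[/= t0 tt] /= Ix /andP[h1t th2]].
have [h10 /andP[h12 h2t]] := hI Ix.
have [hn0 /andP[hn12 hn2t]] := hI In.
set L := (roof_sum f tau n x + h1 (iter n f x) - t)%R.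
(* the entrance is strictly later than the escape *)
have eL : (h2 x < roof_sum f tau n x + h1 (iter n f x))%R.
  case: n n0 In {nmin L h1n} hn0 hn12 hn2t => [//|[|n]] _ In hn0 hn12 hn2t.
    rewrite roof_sum1/= in In hn0 hn12 hn2t *.
    have [h2lt|h2ge] := ltP (h2 x) (tau x); first lra.
    have h2E : h2 x = tau x by apply/eqP; rewrite eq_le h2t.
    have [h1f0|] := eqVneq (h1 (f x)) 0%R; first by exfalso; apply: sep.
    by rewrite neq_lt => /orP[]; lra.
  have := @roof_sum_homo x 2%N n.+2 isT; rewrite (roof_sumS 1) roof_sum1/=.
  by have := tau_gt0 (f x); lra.
split; first exact: ltW.
apply/eqP; rewrite eq_le; apply/andP; split; last first.
  apply: le_ereal_inf_tmp => _ [s [es As] <-]; rewrite lee_fin leNgt; apply/negP => sL.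
  rewrite eE lte_fin in es.
  have [k kn kP] : exists2 k, (k <= n)%N &
      (roof_sum f tau k x <= t + s < roof_sum f tau k.+1 x)%R.
    by apply: lap_exists; rewrite roof_sumS; apply/andP; split; rewrite /L in sL; lra.
  rewrite (@susp_flow_lap _ _ k) //= in As; case: As => _ /= Ik /andP[h1k h2k].
  have [k0|k0] := posnP k.
    by move: h2k; rewrite k0 roof_sum0/=; lra.
  have kE : k = n by apply/eqP; rewrite eqn_leq kn nmin.
  by move: h1k sL; rewrite kE /L; lra.
apply: ereal_inf_lbound; exists L => //; split.
  by rewrite eE lte_fin /L; lra.
have tL : (t + L - roof_sum f tau n x = h1 (iter n f x))%R by rewrite /L; ring.
rewrite (@susp_flow_lap _ _ n)/=; last first.
  by rewrite roof_sumS; apply/andP; split; lra.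
by rewrite tL; split => //=; [rewrite /susp/= hn0 h1n|rewrite lexx].
Qed.

End region.
End orbits.

(** * Recurrence and first hitting times of the base map *)

Section recurrence.
Context d (T : measurableType d) (R : realType).

Lemma measurable_iter (f : T -> T) n :
  measurable_fun setT f -> measurable_fun setT (iter n f).
Proof.
move=> mf; elim: n => [|n ih]; first exact: measurable_id.
exact: measurableT_comp.
Qed.

(** The set [B] of points that visit [I] at some time [k >= 0] contains its
    preimage under [f], and both have the same finite measure; so almost every
    point of [B], hence of [I], lies in that preimage. *)
Lemma poincare_recurrence (mu : {finite_measure set T -> \bar R}) (f : T -> T)
    (I : set T) :
  measurable_fun setT f -> invariant_measure mu f -> measurable I ->
  exists N, [/\ measurable N, mu N = 0 &
    forall x, I x -> ~ N x -> exists2 k, (0 < k)%N & I (iter k f x)].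
Proof.
move=> mf invf mI.
pose B := \bigcup_k (iter k f @^-1` I).
have mB : measurable B.
  apply: bigcup_measurable => k _; rewrite -[X in measurable X]setTI.
  by apply: measurable_iter.
have mfB : measurable (f @^-1` B) by rewrite -[X in measurable X]setTI; exact: mf.
exists (B `\` (f @^-1` B)); split.
- exact: measurableD.
- have fBB : f @^-1` B `<=` B.
    by move=> x [k _ Ik]; exists k.+1 => //=; rewrite -iterS iterSr.
  rewrite measureD// ?fin_num_fun_lty ?ltey_eq ?fin_num_measure//.
  rewrite setIidr//; rewrite [X in _ - X](invf _ mB).
  by rewrite subee// fin_num_measure.
- move=> x Ix nN; have [Bx|nBx] := pselect (B (f x)).
    by case: Bx => k _ Ik; exists k.+1 => //; rewrite iterSr.
  by exfalso; apply: nN; split => //; exists 0%N.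
Qed.

End recurrence.

Lemma first_hitP (T : pointedType) (f : T -> T) (I : set T) (x : T) :
  (exists2 k, (0 < k)%N & I (iter k f x)) ->
  let n := first_hit f I x in
  [/\ (0 < n)%N, I (iter n f x) &
    forall j, (0 < j)%N -> I (iter j f x) -> (n <= j)%N].
Proof.
move=> [k k0 Ik].
have ex : exists j, (0 < j)%N && `[< I (iter j f x) >].
  by exists k; rewrite k0; apply/asboolP.
have xn : [set k | [/\ (0 < k)%N, I (iter k f x) &
    forall j, (0 < j)%N -> I (iter j f x) -> (k <= j)%N]] (ex_minn ex).
  case: ex_minnP => n /andP[n0 /asboolP In] nmin; split => // j j0 Ij.
  by apply: nmin; rewrite j0; apply/asboolP.
exact: (xgetI 0%N xn).
Qed.

(** On a set of points that return to [I], a quantity evaluated at the first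
    hitting time is measurable, because the level sets of the hitting time form
    a countable measurable partition. *)
Lemma measurable_first_hit_comp d d' (T : measurableType d)
    (U : measurableType d') (f : T -> T) (I J : set T) (g : nat -> T -> U) :
  measurable_fun setT f -> measurable I -> measurable J ->
  (forall x, J x -> exists2 k, (0 < k)%N & I (iter k f x)) ->
  (forall k, measurable_fun (J `&` [set x | first_hit f I x = k]) (g k)) ->
  measurable_fun J (fun x => g (first_hit f I x) x).
Proof.
move=> mf mI mJ ret mg.
pose E k := J `&` [set x | first_hit f I x = k].
have mIk k : measurable (iter k f @^-1` I).
  by rewrite -[X in measurable X]setTI; exact: measurable_iter.
have mE k : measurable (E k).
  case: k => [|k].
    rewrite (_ : E 0%N = set0)//; apply/seteqP; split => // x [Jx /= n0].
    by have [] := first_hitP (ret _ Jx); rewrite n0.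
  rewrite (_ : E k.+1 = J `&` ((iter k.+1 f @^-1` I) `&`
      \bigcap_(j in [set j | (0 < j < k.+1)%N]) ~` (iter j f @^-1` I))).
    apply: measurableI => //; apply: measurableI => //.
    by apply: bigcap_measurableType => j _; apply: measurableC.
  apply/seteqP; split=> x [Jx].
    move=> /= nE; split => //.
    have [n0 In nmin] := first_hitP (ret _ Jx); rewrite nE in In nmin.
    split => // j /andP[j0 jk] Ij.
    by have := nmin _ j0 Ij; rewrite leqNgt jk.
  move=> [Ik nI]; split => //=.
  have [n0 In nmin] := first_hitP (ret _ Jx).
  apply/eqP; rewrite eqn_leq nmin//= leqNgt; apply/negP => lt.
  by apply: (nI (first_hit f I x)) => //=; rewrite n0.
have -> : J = \bigcup_k E k.
  by apply/seteqP; split => [x Jx|x [k _ []]//]; exists (first_hit f I x).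
apply/measurable_fun_bigcup => // k.
apply: eq_measurable_fun (mg k) => x; rewrite inE => -[_ /= <-] //.
Qed.

(** * Null sets and sums of non-integrable functions *)

Section integrals.
Context d (T : measurableType d) (R : realType) (mu : {measure set T -> \bar R}).
Import HBNNSimple.

(** The integral is defined as a supremum over simple functions, which can be
    multiplied by the indicator of the complement of [N] without changing their
    integral; so measurability of [g] does not matter. *)
Lemma ge0_integral_setD_null (D N : set T) (g : T -> \bar R) :
  measurable N -> mu N = 0 -> measurable D ->
  (forall x, D x -> 0 <= g x) ->
  \int[mu]_(x in D) g x = \int[mu]_(x in D `\` N) g x.
Proof.
move=> mN N0 mD g0.
rewrite !ge0_integralE//; last by move=> x [Dx _]; exact: g0.
apply/eqP; rewrite eq_le; apply/andP; split; apply: ge_ereal_sup => _ [h /= hg <-].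
  have mCN : measurable (~` N) by exact: measurableC.
  have prE x : proj_nnsfun h mCN x = (h \_ (~` N)) x by rewrite mrestrict.
  apply: (@le_trans _ _ (sintegral mu (h \_ (~` N)))).
    rewrite -integral_nnsfun// -integralT_nnsfun.
    rewrite (@ge0_negligible_integral _ _ _ _ setT N)// ?setTD//.
    - by apply/measurable_EFinP; exact: measurable_funTS.
    - by move=> x _; rewrite lee_fin.
  rewrite mrestrict; apply: ereal_sup_ubound.
  exists (proj_nnsfun h mCN) => //; rewrite /mkset => x.
  rewrite prE /patch; case: ifPn => xN.
    move: (hg x); rewrite /patch; case: ifPn => xD.
      by rewrite mem_set//; rewrite !inE in xN xD.
    by rewrite memNset// => -[Dx _]; rewrite mem_set in xD.
  by rewrite memNset//; rewrite notin_setE in xN => -[].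
apply: ereal_sup_ubound; exists h => //= x; apply: le_trans (hg x) _.
rewrite /patch; case: ifPn => [|_]; first by rewrite inE => -[Dx _]; rewrite mem_set.
by case: ifPn => //; rewrite inE => /g0.
Qed.

Lemma integral_setD_null (D N : set T) (g : T -> \bar R) :
  measurable N -> mu N = 0 -> measurable D ->
  \int[mu]_(x in D) g x = \int[mu]_(x in D `\` N) g x.
Proof.
move=> mN N0 mD; rewrite integralE [RHS]integralE.
by congr (_ - _); apply: ge0_integral_setD_null.
Qed.

(** The negative part of [G] is at most [F].  If it has a finite integral, it
    can be subtracted from an identity between nonnegative integrals; otherwise
    the two integrals are [+oo] and [-oo], which the definedness of the sum
    excludes. *)
Lemma integralD_adde_def (D : set T) (F G : T -> R) : measurable D ->
  measurable_fun D F -> measurable_fun D G ->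
  (forall x, D x -> (0 <= F x)%R) -> (forall x, D x -> (0 <= F x + G x)%R) ->
  \int[mu]_(x in D) (F x)%:E +? \int[mu]_(x in D) (G x)%:E ->
  \int[mu]_(x in D) (F x + G x)%:E =
    \int[mu]_(x in D) (F x)%:E + \int[mu]_(x in D) (G x)%:E.
Proof.
move=> mD mF mG F0 FG0.
pose Gp x := Num.max (G x) 0%R; pose Gn x := Num.max (- G x)%R 0%R.
have mGp : measurable_fun D Gp by exact: measurable_maxr.
have mGn : measurable_fun D Gn by apply: measurable_maxr => //; exact: measurableT_comp.
have Gp0 x : (0 <= Gp x)%R by rewrite le_max lexx orbT.
have Gn0 x : (0 <= Gn x)%R by rewrite le_max lexx orbT.
have GE x : G x = (Gp x - Gn x)%R.
  by rewrite /Gp /Gn; case: (leP (G x) 0%R) => g0; case: (leP (- G x)%R 0%R); lra.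
have iG : \int[mu]_(x in D) (G x)%:E =
    \int[mu]_(x in D) (Gp x)%:E - \int[mu]_(x in D) (Gn x)%:E.
  rewrite integralE; congr (_ - _); apply: eq_integral => x _.
    by rewrite funeposE -EFin_max.
  by rewrite funenegE -EFinN -EFin_max.
have GnF : \int[mu]_(x in D) (Gn x)%:E <= \int[mu]_(x in D) (F x)%:E.
  apply: ge0_le_integral => //; [|exact/measurable_EFinP|exact/measurable_EFinP|].
    by move=> x _; rewrite lee_fin.
  by move=> x Dx; rewrite lee_fin ge_max F0// andbT; have := FG0 _ Dx; lra.
have iF0 : 0 <= \int[mu]_(x in D) (F x)%:E.
  by apply: integral_ge0 => x Dx; rewrite lee_fin F0.
have iGn0 : 0 <= \int[mu]_(x in D) (Gn x)%:E.
  by apply: integral_ge0 => x Dx; rewrite lee_fin.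
have iGp0 : 0 <= \int[mu]_(x in D) (Gp x)%:E.
  by apply: integral_ge0 => x Dx; rewrite lee_fin.
have mFG : measurable_fun D (fun x => F x + G x)%R by exact: measurable_funD.
have key : \int[mu]_(x in D) (F x)%:E + \int[mu]_(x in D) (Gp x)%:E =
    \int[mu]_(x in D) (F x + G x)%:E + \int[mu]_(x in D) (Gn x)%:E.
  rewrite -!ge0_integralD//; try exact/measurable_EFinP;
    try by move=> x Dx; rewrite lee_fin ?F0 ?FG0.
  by apply: eq_integral => x _; rewrite -!EFinD GE; congr (_%:E); ring.
have [Gnfin|] := boolP (\int[mu]_(x in D) (Gn x)%:E \is a fin_num).
  by move=> _; rewrite iG addeA key addeK.
rewrite ge0_fin_numE// -leNgt leye_eq => /eqP Gny.
move: GnF; rewrite Gny leye_eq => /eqP Fy.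
by rewrite Fy iG Gny /= addeNy /adde_def.
Qed.

End integrals.

(** * Integration over a region between two graphs *)

Section area.
Context d (T : measurableType d) (R : realType) (mu : {measure set T -> \bar R}).

(** The product with Lebesgue measure, seen as a measure on [T * R].  The
    Lebesgue measure is defined on [measurableTypeR R], a copy of [R] with the
    same measurable sets but another display; integrals over the two structures
    are different terms, which [ge0_integral_area] identifies. *)
Definition area : set (T * R) -> \bar R := mu \x @lebesgue_measure R.

HB.instance Definition _ := isMeasure.Build _ _ _ area
  (measure0 (mu \x @lebesgue_measure R))
  (measure_ge0 (mu \x @lebesgue_measure R))
  (@measure_semi_sigma_additive _ _ _ (mu \x @lebesgue_measure R)).

Lemma ge0_integral_area (D : set (T * R)) (g : T * R -> \bar R) :
  measurable D -> measurable_fun D g -> (forall p, D p -> 0 <= g p) ->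
  \int[area]_(p in D) g p = \int[mu \x @lebesgue_measure R]_(p in D) g p.
Proof.
move=> mD mg g0.
pose phi (p : T * measurableTypeR R) : T * R := p.
have mphi : measurable_fun setT phi by move=> _ Y mY; rewrite setTI; exact: mY.
rewrite -[RHS](ge0_integral_pushforward mphi (mu \x @lebesgue_measure R) mD mg)//.
by move=> p; rewrite inE => /g0.
Qed.

End area.

Section fibres.
Context d (T : measurableType d) (R : realType)
  (mu : {sigma_finite_measure set T -> \bar R}).
Local Notation leb := (@lebesgue_measure R).

Lemma integral_linear_itv (a b c : R) : (a <= b)%R ->
  \int[leb]_(t in `[a, b]) (b - t + c)%:E =
  ((b - a) * ((b - a) / 2 + c))%:E.
Proof.
rewrite le_eqVlt => /predU1P[->|ab].
  by rewrite set_itv1 integral_set1 subrr mul0r.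
(* an antiderivative of the integrand *)
pose F t : R := ((b + c) * t - 2^-1 * t ^+ 2)%R.
have dF (t : R) : is_derive t 1%R F (b - t + c)%R.
  apply: is_derive_eq; rewrite /GRing.scale/=; lra.
have cF : continuous F.
  move=> t; apply: differentiable_continuous; apply/derivable1_diffP.
  by have [] := dF t.
rewrite (@continuous_FTC2 _ _ F)//.
- by rewrite -EFinB /F; congr (_%:E); field.
- apply: continuous_subspaceT => t.
  apply: cvgD; last exact: cvg_cst.
  by apply: cvgB; [exact: cvg_cst|exact: cvg_id].
- split.
  + by move=> t _; have [] := dF t.
  + apply: cvg_at_right_filter; exact: cF.
  + apply: cvg_at_left_filter; exact: cF.
- by move=> t _; rewrite derive1E; have [_ ->] := dF t.
Qed.

Variables (J : set T) (u v w : T -> R).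
Hypotheses (mJ : measurable J) (measurable_u : measurable_fun J u)
  (mv : measurable_fun J v) (mw : measurable_fun J w).
Hypothesis uvw : forall x, J x -> (0 <= u x)%R /\ (u x <= v x <= w x)%R.
Let A : set (T * R) :=
  [set p | [/\ susp w p, J p.1 & (u p.1 <= p.2 <= v p.1)%R]].

Let JR : set (T * R) := J `*` setT.

Let mJR : measurable JR. Proof. exact: measurableX. Qed.

Let measurable_fun_fst (g : T -> R) :
  measurable_fun J g -> measurable_fun JR (fun p => g p.1).
Proof.
move=> mg; apply: (measurable_comp mJ _ mg); first by move=> _ [p [Jp _] <-].
exact: measurable_funTS measurable_fst.
Qed.

Let measurable_fun_snd : measurable_fun JR (fun p => p.2).
Proof. exact: measurable_funTS measurable_snd. Qed.

Lemma measurable_region : measurable A.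
Proof.
have -> : A = (JR `&` [set p : T * R | (u p.1 <= p.2)%R]) `&`
    (JR `&` [set p : T * R | (p.2 <= v p.1)%R]) `&`
    (JR `&` [set p : T * R | (p.2 < w p.1)%R]).
  apply/seteqP; split => [[x t]|[x t]].
    by move=> [/andP[/= t0 tw] /= Jx /andP[/= ut tv]].
  move=> [[[[/= Jx _] /= ut] [_ /= tv]] [_ /= tw]].
  split => //; last by rewrite /= ut.
  by rewrite /susp /= tw andbT; have [u0 _] := uvw Jx; exact: le_trans ut.
apply: measurableI; first apply: measurableI.
- by apply: measurable_fun_le => //; exact: measurable_fun_fst.
- by apply: measurable_fun_le => //; exact: measurable_fun_fst.
- have /(_ mJR [set true]) :=
    measurable_fun_ltr measurable_fun_snd (measurable_fun_fst mw).
  by apply.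
Qed.

(** The fibre lacks its top point exactly when that point lies on the roof,
    where it is represented by a point of the next fibre. *)
Lemma xsection_region x : J x -> exists b0,
  xsection A x = [set` Interval (BLeft (u x)) (BSide b0 (v x))].
Proof.
move=> Jx; have [u0 /andP[uv vw]] := uvw Jx.
have [vltw|wlev] := ltP (v x) (w x).
  exists false; apply/seteqP; split => t; rewrite /xsection/= in_itv/=.
    by rewrite inE => -[].
  move=> /andP[ut tv]; rewrite inE; split => //=; last by rewrite ut.
  by rewrite /susp/= (le_trans u0 ut)/= (le_lt_trans tv).
have vE : v x = w x by apply/eqP; rewrite eq_le vw.
exists true; apply/seteqP; split => t; rewrite /xsection/= in_itv/=.
  by rewrite inE => -[/andP[/= _ tw] _ /andP[/= -> _]]; rewrite vE.
move=> /andP[ut tv]; rewrite inE; split => //=; last by rewrite ut ltW.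
by rewrite /susp/= (le_trans u0 ut)/= -vE.
Qed.

Lemma measurable_affine_region (b : T -> R) : measurable_fun J b ->
  measurable_fun A (fun p => (v p.1 - p.2 + b p.1)%:E).
Proof.
move=> mb; apply: (@measurable_funS _ _ _ _ JR) => //; first by move=> p [_ Jp _].
apply/measurable_EFinP; apply: measurable_funD; last exact: measurable_fun_fst.
by apply: measurable_funB => //; exact: measurable_fun_fst.
Qed.

Lemma integral_region (b : T -> R) : measurable_fun J b ->
  (forall x, J x -> (0 <= b x)%R) ->
  \int[area mu]_(p in A) (v p.1 - p.2 + b p.1)%:E =
  \int[mu]_(x in J) ((v x - u x) * ((v x - u x) / 2 + b x))%:E.
Proof.
move=> mb b0.
have mA := measurable_region.
pose g (p : T * R) := (v p.1 - p.2 + b p.1)%:E.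
have mg : measurable_fun A g by exact: measurable_affine_region.
have g0 p : A p -> 0 <= g p.
  by move=> [_ Jp /andP[_ pv]]; rewrite lee_fin; have := b0 _ Jp; lra.
rewrite ge0_integral_area// integral_mkcond fubini_tonelli1.
- rewrite [RHS]integral_mkcond; apply: eq_integral => x _.
  rewrite /fubini_F [in RHS]/patch; case: ifPn => xJ.
    rewrite inE in xJ; have [u0 /andP[uv vw]] := uvw xJ.
    rewrite -integral_linear_itv//.
    rewrite (_ : (fun y => _) =
      (fun t => (v x - t + b x)%:E) \_ (xsection A x)); last first.
      by apply/funext => t; rewrite /patch mem_xsection.
    rewrite -integral_mkcond; have [b1 ->] := xsection_region xJ.
    case: b1; last by [].
    rewrite integral_itv_bndo_bndc//; apply/measurable_EFinP; apply: measurable_funTS.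
    by apply: measurable_funD => //; exact: measurable_funB.
  apply: integral0_eq => t _; rewrite /patch; case: ifPn => //.
  by rewrite inE => -[_ /= Jx _]; rewrite mem_set in xJ.
- by apply/(measurable_restrictT _ _).1.
- by move=> p; exact: erestrict_ge0.
Qed.

Lemma measure_region : area mu A = \int[mu]_(x in J) (v x - u x)%:E.
Proof.
rewrite /area /product_measure1 [RHS]integral_mkcond; apply: eq_integral => x _ /=.
rewrite /patch; case: ifPn => xJ.
  rewrite inE in xJ; have [u0 /andP[uv vw]] := uvw xJ.
  have [b1 ->] := xsection_region xJ.
  rewrite lebesgue_measure_itv/= lte_fin; case: ltP => // vu.
  by rewrite (_ : v x = u x) ?subrr//; apply/eqP; rewrite eq_le vu.
rewrite (_ : xsection A x = set0) ?measure0//; apply/seteqP; split => // t.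
by rewrite /xsection/= inE => -[_ /= Jx _]; rewrite mem_set in xJ.
Qed.

End fibres.

(** * Integration with respect to a conditioned measure *)

Section conditioning.
Context d (T : measurableType d) (R : realType).

(** On subsets of [A], conditioning is multiplication by [1 / m A]: a constant
    factor between [nu] and [m] on [A] cancels out. *)
Lemma integral_cond_measure (m : {measure set (T * R) -> \bar R})
    (nu : set (T * R) -> \bar R) (A : set (T * R)) (M c : R) :
  measurable A -> m A = M%:E -> (0 < M)%R -> (0 < c)%R ->
  (forall B, B `<=` A -> nu B = m B * c%:E) ->
  forall (N : set (T * R)) (g g' : T * R -> \bar R),
  measurable N -> m N = 0 ->
  (forall p, (A `\` N) p -> g p = g' p) ->
  (forall p, (A `\` N) p -> 0 <= g' p) ->
  measurable_fun (A `\` N) g' ->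
  \int[cond_measure nu A]_(p in A) g p =
    (\int[m]_(p in A `\` N) g' p) / M%:E.
Proof.
move=> mA mAM M0 c0 nuE N g g' mN N0 gg' g'0 mg'.
have Mi0 : (0 <= M^-1)%R by rewrite invr_ge0 ltW.
pose k : {nonneg R} := NngNum Mi0.
have nuM : nu A = (M * c)%:E by rewrite nuE// mAM.
have condE : cond_measure nu A = mscale k (mrestr m mA).
  apply/funext => B; rewrite /cond_measure /mscale/= /mrestr nuM nuE; last exact: subIsetr.
  rewrite inver mulf_eq0 !gt_eqF//= -muleA -EFinM muleC; congr (_%:E * _).
  by rewrite invfM mulrCA divff ?gt_eqF// mulr1.
have mAN : measurable (A `\` N) by exact: measurableD.
have kN0 : mscale k (mrestr m mA) N = 0.
  rewrite /mscale/= /mrestr (_ : m (N `&` A) = 0) ?mule0//.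
  by apply: (subset_measure0 _ mN _ N0) => //; exact: measurableI.
rewrite condE (integral_setD_null _ mN kN0 mA).
rewrite (eq_measure_integral (mscale k m)); last first.
  move=> B mB BA; rewrite /mscale/= /mrestr; congr (_ * m _).
  by apply: setIidl => p /BA[].
rewrite (eq_integral g'); last by move=> p; rewrite inE => /gg'.
by rewrite ge0_integral_mscale//= inver gt_eqF// muleC.
Qed.

End conditioning.

(** * The mean return time formula *)

Theorem theorem2 (R : realType) (S : ptopologicalType)
    (f : borel S -> borel S) (mu : probability (borel S) R)
    (tau : borel S -> R) (A : set (borel S * R)) (h1 h2 : borel S -> R) :
  measurable_fun setT f ->
  invariant_measure mu f ->
  ergodic_measure mu f ->
  mu.-integrable setT (EFin \o tau) ->
  (exists2 c : R, (0 < c)%R & forall x, (c <= tau x)%R) ->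
  graph_bounded tau A h1 h2 ->
  let I := fst @` A in
  separated_fibres mu f tau I h1 h2 ->
  let mubar := susp_measure mu tau in
  0 < mubar A ->
  let mubarA := cond_measure mubar A in
  let h x := (h2 x - h1 x)%R in
  let n_I := first_hit f I in
  let return_term :=
    (\int[mu]_(x in I) (h x * roof_sum f tau (n_I x) x)%:E)
      / (\int[mu]_(x in I) (h x)%:E) in
  let height_term :=
    (\int[mu]_(x in I) (h x * (h1 (iter (n_I x) f x) - h2 x))%:E)
      / (\int[mu]_(x in I) (h x)%:E) in
  let mean_escape := \int[mubarA]_(p in A) escape_time f tau A p in
  (* the right-hand side of the first formula is not of the form +oo - oo *)
  (return_term +? height_term ->
   \int[mubarA]_(p in A) hitting_time f tau A p
     = mean_escape + return_term + height_term) /\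
  mean_escape
    = (\int[mu]_(x in I) (h x * ((h2 x - h1 x) / 2))%:E)
        / (\int[mu]_(x in I) (h x)%:E).
Proof.
move=> mf invf _ itau [c0 c0_gt0 c_le] [mI mh1 mh2 hI AE] I sep mubar muA_gt0.
rewrite -/I in mI mh1 mh2 hI AE.
have tau_gt0 x : (0 < tau x)%R by exact: lt_le_trans (c_le x).
have h1_lt_tau y : I y -> (h1 y < tau y)%R.
  rewrite /I => -[p + <-]; rewrite AE => -[/andP[_ ptau] _ /andP[h1p _]].
  exact: le_lt_trans ptau.
(* I was defined from A; forgetting this lets A be replaced by the region
   between the graphs *)
clearbody I; subst A.
set A := [set p | _] in mubar muA_gt0 *.
move=> mubarA h n_I return_term height_term mean_escape.
have mtau : measurable_fun setT tau by apply/measurable_EFinP; exact: measurable_int itau.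
pose mm : {measure set (borel S * R) -> \bar R} := area mu.
have mA : measurable A.
  by apply: measurable_region => //; exact: measurable_funTS.
have mmA : mm A = \int[mu]_(x in I) (h x)%:E.
  by apply: measure_region => //; exact: measurable_funTS.
have mh : measurable_fun I h by exact: measurable_funB.
have h_ge0 x : I x -> (0 <= h x)%R.
  by move=> /hI[_ /andP[h12 _]]; rewrite subr_ge0.
(* the conditioned measure is area mu, restricted to A and divided by M *)
pose T0 := fine (\int[mu]_x (tau x)%:E).
have T0E : \int[mu]_x (tau x)%:E = T0%:E by rewrite fineK// integrable_fin_num.
have T0_gt0 : (0 < T0)%R.
  rewrite -lte_fin -T0E; apply: (@lt_le_trans _ _ (\int[mu]_x (cst c0%:E x))).
    by rewrite integral_cst// [X in _ * X](probability_setT mu) mule1 lte_fin.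
  apply: ge0_le_integral => //; [by move=> x _; rewrite lee_fin ltW|
    exact/measurable_EFinP|by move=> x _; rewrite lee_fin].
have mubarE B : B `<=` A -> mubar B = mm B * T0^-1%:E.
  move=> BA; rewrite /mubar /susp_measure T0E inver gt_eqF//; congr (mm _ * _).
  by apply: setIidl => p /BA[].
have mmA_ge0 : 0 <= mm A by exact: measure_ge0.
have mmA_lty : mm A < +oo.
  rewrite mmA; apply: (@le_lt_trans _ _ (\int[mu]_x (tau x)%:E)); last by rewrite T0E ltry.
  rewrite [leLHS]integral_mkcond; apply: ge0_le_integral => //.
  - by move=> x _; apply: erestrict_ge0 => y Iy; rewrite lee_fin h_ge0.
  - by apply/(measurable_restrictT _ _).1 => //; exact/measurable_EFinP.
  - exact/measurable_EFinP.
  - move=> x _; rewrite /patch; case: ifPn => xI; last by rewrite lee_fin ltW.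
    by rewrite inE in xI; rewrite lee_fin /h; have [? /andP[]] := hI _ xI; lra.
pose M := fine (mm A).
have ME : mm A = M%:E by rewrite fineK// ge0_fin_numE.
have M_gt0 : (0 < M)%R.
  rewrite -lte_fin -ME lt_neqAle mmA_ge0 andbT; apply: contraTN muA_gt0 => /eqP m0.
  by rewrite mubarE// -m0 mul0e ltxx.
have hM : \int[mu]_(x in I) (h x)%:E = M%:E by rewrite -mmA.
(* J is I without the points that do not return and those with glued fibres *)
have [N1 [mN1 N10 ret]] := poincare_recurrence mf invf mI.
have [N2 [mN2 N20 sepN]] := sep.
pose N := N1 `|` N2.
have mN : measurable N by exact: measurableU.
have N0 : mu N = 0 by rewrite /N measureU0.
pose J := I `\` N.
have mJ : measurable J by exact: measurableD.
have JI : J `<=` I by move=> x [].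
have n_IP x : J x -> [/\ (0 < n_I x)%N, I (iter (n_I x) f x) &
    forall j, (0 < j)%N -> I (iter j f x) -> (n_I x <= j)%N].
  by move=> [Ix nN]; apply: first_hitP; apply: ret => // ?; apply: nN; left.
have Jsep x : J x -> ~ [/\ I x, h2 x = tau x, I (f x) & h1 (f x) = 0%R].
  by move=> [Ix nN] bad; apply: nN; right; apply: sepN => /= /(_ bad).
have hJ x : J x -> (0 <= h1 x)%R /\ (h1 x <= h2 x <= tau x)%R.
  by move=> /JI; exact: hI.
have mh1J : measurable_fun J h1 by exact: measurable_funS mh1.
have mh2J : measurable_fun J h2 by exact: measurable_funS mh2.
have mhJ : measurable_fun J h by exact: measurable_funS mh.
have mtauJ : measurable_fun J tau by exact: measurable_funTS.
pose NR : set (borel S * R) := N `*` setT.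
have mNR : measurable NR by exact: measurableX.
have NR0 : mm NR = 0.
  by rewrite /mm/= /area product_measure1E//; rewrite [X in X * _]N0 mul0e.
pose AJ : set (borel S * R) :=
  [set p | [/\ susp tau p, J p.1 & (h1 p.1 <= p.2 <= h2 p.1)%R]].
have ADE : A `\` NR = AJ.
  apply/seteqP; split => [p [[sp Ip hp] nN]|p [sp [Ip nN] hp]].
    by split => //; split => // Np; apply: nN.
  by split => // -[].
(* the integral over A of a function that is affine on the fibres over J *)
have integral_mubarA (e : borel S * R -> \bar R) (b : borel S -> R) :
    measurable_fun J b -> (forall x, J x -> (0 <= b x)%R) ->
    (forall p, AJ p -> e p = (h2 p.1 - p.2 + b p.1)%:E) ->
    \int[mubarA]_(p in A) e p =
      (\int[mu]_(x in J) (h x * ((h2 x - h1 x) / 2 + b x))%:E) / M%:E.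
  move=> mb b0 eE.
  have Ti0 : (0 < T0^-1)%R by rewrite invr_gt0.
  rewrite (integral_cond_measure mA ME M_gt0 Ti0 mubarE mNR NR0
    (g' := fun p => (h2 p.1 - p.2 + b p.1)%:E)).
  - by rewrite ADE (integral_region mu mJ mh1J mh2J mtauJ hJ mb b0).
  - by rewrite ADE.
  - rewrite ADE => p [_ Jp /andP[_ ph2]]; rewrite lee_fin.
    by have := b0 _ Jp; lra.
  - by rewrite ADE; exact: measurable_affine_region.
have escapeE : mean_escape =
    (\int[mu]_(x in J) (h x * ((h2 x - h1 x) / 2))%:E) / M%:E.
  rewrite /mean_escape (integral_mubarA _ (fun=> 0%R))//.
    by congr (_ / _); apply: eq_integral => x _; rewrite addr0.
  move=> [x t] /= xtJ; rewrite addr0.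
  apply: (escape_time_region tau_gt0 hI); last by case: xtJ => _ /Jsep.
  by case: xtJ => ? /JI.
have eqJ (g : borel S -> \bar R) : \int[mu]_(x in I) g x = \int[mu]_(x in J) g x.
  exact: integral_setD_null.
split; last by rewrite hM eqJ.
(* for x in J, the hitting time exceeds the escape time by r x + q x *)
pose r x := roof_sum f tau (n_I x) x.
pose q x := (h1 (iter (n_I x) f x) - h2 x)%R.
have hit x t : AJ (x, t) -> (0 <= r x + q x)%R /\
    hitting_time f tau A (x, t) = (h2 x - t + (r x + q x))%:E.
  move=> [sxt Jx xt].
  have Axt : A (x, t) by split => //; exact: JI.
  have [n0 In nmin] := n_IP _ Jx.
  have [hle ->] := hitting_time_region tau_gt0 hI Axt (Jsep _ Jx)
    (h1_lt_tau _ In) (And3 n0 In nmin).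
  by rewrite /r /q; split; [lra|congr (_%:E); ring].
(* r + q is nonnegative over J because every fibre contains its bottom point *)
have rq_ge0 x : J x -> (0 <= r x + q x)%R.
  move=> Jx; have [h10 /andP[h12 h2t]] := hJ _ Jx.
  apply: (proj1 (hit x (h1 x) _)); split => //=; last by rewrite lexx.
  by rewrite /susp/= h10 h1_lt_tau//; exact: JI.
have retJ x : J x -> exists2 k, (0 < k)%N & I (iter k f x).
  by move=> /n_IP[? ? _]; exists (n_I x).
have mr : measurable_fun J r.
  apply: (measurable_first_hit_comp (g := roof_sum f tau) mf mI mJ retJ) => k.
  apply: measurable_funTS; apply: measurable_sum => j.
  by apply: measurableT_comp => //; exact: measurable_iter.
have mq : measurable_fun J q.
  apply: measurable_funB => //.
  apply: (measurable_first_hit_comp (g := fun k x => h1 (iter k f x)) mf mI mJ retJ) => k.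
  apply: (measurable_comp mI _ mh1); last exact: measurable_funTS (measurable_iter k mf).
  by move=> _ [x [Jx <-] <-]; have [] := n_IP _ Jx.
have r_ge0 x : (0 <= r x)%R.
  by rewrite /r /roof_sum; apply: sumr_ge0 => j _; rewrite ltW.
have mrq : measurable_fun J (fun x => r x + q x)%R by exact: measurable_funD.
rewrite /return_term /height_term hM !eqJ => rh.
rewrite escapeE (integral_mubarA _ (fun x => r x + q x)%R)//; last first.
  by move=> [x t] /hit[].
set F := \int[mu]_(x in J) (h x * r x)%:E; set G := \int[mu]_(x in J) (h x * q x)%:E.
have Mi_gt0 : (0 < M^-1)%R by rewrite invr_gt0.
have ME1 : M%:E^-1 = M^-1%:E by rewrite inver gt_eqF.
have FG : F +? G.
  move: rh; rewrite -/F -/G ME1.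
  by case: (F) (G) => [F'||] [G'||]//; rewrite ?gt0_mulye ?gt0_mulNye ?lte_fin.
have hhE x : (h x * ((h2 x - h1 x) / 2 + (r x + q x)) =
   h x * ((h2 x - h1 x) / 2) + (h x * r x + h x * q x))%R by ring.
under eq_integral do rewrite hhE EFinD.
have mhh : measurable_fun J (fun x => h x * ((h2 x - h1 x) / 2))%R.
  by apply: measurable_funM => //; exact: measurable_funM.
have mhr : measurable_fun J (fun x => h x * r x)%R by exact: measurable_funM.
have mhq : measurable_fun J (fun x => h x * q x)%R by exact: measurable_funM.
rewrite ge0_integralD//; last 4 first.
- move=> x Jx; rewrite lee_fin; have := h_ge0 _ (JI _ Jx) => ?.
  by rewrite mulr_ge0// divr_ge0.
- exact/measurable_EFinP.
- by move=> x Jx; rewrite lee_fin -mulrDr mulr_ge0 ?rq_ge0// h_ge0//; exact: JI.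
- by apply/measurable_EFinP; exact: measurable_funD.
rewrite integralD_adde_def//; last 2 first.
- by move=> x /JI/h_ge0 ?; rewrite mulr_ge0.
- by move=> x Jx; rewrite -mulrDr mulr_ge0 ?rq_ge0// h_ge0//; exact: JI.
rewrite -/F -/G ME1.
set E := \int[mu]_(x in J) _.
have E0 : 0 <= E.
  apply: integral_ge0 => x Jx; have := h_ge0 _ (JI _ Jx) => ?.
  by rewrite lee_fin mulr_ge0// divr_ge0.
have FG0 : 0 <= F + G.
  rewrite -integralD_adde_def//.
  - by apply: integral_ge0 => x Jx; rewrite lee_fin -mulrDr mulr_ge0 ?rq_ge0// h_ge0//; exact: JI.
  - by move=> x /JI/h_ge0 ?; rewrite mulr_ge0.
  - by move=> x Jx; rewrite -mulrDr mulr_ge0 ?rq_ge0// h_ge0//; exact: JI.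
have EFG : E +? (F + G) by apply: ge0_adde_def; rewrite inE.
by rewrite (muleDl _ EFG)// (muleDl _ FG)// addeA.
Qed.
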